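(* The following two statements (A) and (B) are equivalent. (A) For all $n,s\ge 1$ and every system $f_1,\dots,f_s$ of tropical polynomials in $n$ variables (in convex form): the system $f_1,\dots,f_s$ has a common tropical zero in $\mathbb{R}^n$ if and only if the Cayley matrix $C(f_1,\dots,f_s)$ has a tropical zero. (B) For all $n,s\ge 1$, every system $f_1,\dots,f_s$ of tropical polynomials in $n$ variables (in convex form), and every family $(y_J)_{J\in\mathbb{Z}^n}$ of real numbers, put $Y:=\{(-y_J,J): J\in\mathbb{Z}^n\}\subset\mathbb{R}^{n+1}$, and for $I\in\mathbb{Z}^n$, $1\le j\le s$ let $a=a_{I,j}\in\mathbb{R}$ be minimal such that the polyhedron $P(f_j)+(a,I)$ lies above $Y$. Assume that for all $I\in\mathbb{Z}^n$ and $1\le j\le s$ the polyhedron $P(f_j)+(a_{I,j},I)$ and $Y$ have at least two common points. Then there exists a hyperplane $H\subset\mathbb{R}^{n+1}$ defined by a linear equation $z_1+b_2 z_2+\cdots+b_{n+1}z_{n+1}=0$ with $b_2,\dots,b_{n+1}\in\mathbb{R}$ such that for each $1\le j\le s$, for the minimal $b\in\mathbb{R}$ with the property that $P(f_j)$ lies above the hyperplane $H-(b,0)$, the intersection of $P(f_j)$ and $H-(b,0)$ has at least two points.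
   Context: The tropical semi-ring is $\mathbb{R}_\infty=\mathbb{R}\cup\{\infty\}$ with $\oplus=\min$, $\otimes=+$. Zeros are taken over $\mathbb{R}$. A tropical polynomial in $n$ variables is a finite tropical sum $f=\bigoplus_l a_l\otimes X_1^{\otimes i_{1,l}}\otimes\cdots\otimes X_n^{\otimes i_{n,l}}$ with $a_l\in\mathbb{R}$ and pairwise distinct exponent vectors of nonnegative integers (at least one monomial). Absent monomials have coefficient $\infty$. A point $x\in\mathbb{R}^n$ is a tropical zero of $f$ if $\min_l\{a_l+i_{1,l}x_1+\cdots+i_{n,l}x_n\}$ is attained for at least two different $l$. A tropical zero of a system is a common tropical zero of its members. The (extended) Newton polyhedron $P(f)\subset\mathbb{R}^{n+1}$ is the convex hull of the points $(a_l,i_{1,l},\dots,i_{n,l})$, enlarged by adding, for each point $(a,b_1,\dots,b_n)$ of this convex hull, the ray $\{(b,b_1,\dots,b_n): b\ge a\}$. $f$ is in convex form if its monomials are exactly those whose exponent vector $I\in\mathbb{Z}^n$ satisfies $(a,I)\in P(f)$ for some $a$, with coefficient the minimal such $a$. All tropical polynomials are considered in convex form. The Cayley matrix $C(f_1,\dots,f_s)$ over $\mathbb{R}_\infty$ has columns indexed by $J\in\mathbb{Z}^n$ and rows indexed by pairs $(I,j)$, $I\in\mathbb{Z}^n$, $1\le j\le s$. The entry in row $(I,j)$ and column $J$ is the coefficient of $X^{\otimes(J-I)}$ in $f_j$ ($\infty$ if absent), so that the row $(I,j)$ lists the coefficients of $X^{\otimes I}\otimes f_j$. A tropical zero of this matrix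 is a family $(y_J)_{J\in\mathbb{Z}^n}$ of real numbers such that for every row the minimum over $J$ of (entry in column $J$) $+\,y_J$ is attained for at least two different $J$. A set $U\subset\mathbb{R}^{n+1}$ lies above a set $V\subset\mathbb{R}^{n+1}$ if for any pair of points $(u_1,w_1,\dots,w_n)\in U$, $(v_1,w_1,\dots,w_n)\in V$ (with the same last $n$ coordinates) one has $u_1\ge v_1$. For $a\in\mathbb{R}$ and $I\in\mathbb{Z}^n$, $P+(a,I)$ denotes the translate of $P$ by the vector $(a,I)\in\mathbb{R}\times\mathbb{Z}^n$. $H-(b,0)$ is the translate of $H$ by the vector $(-b,0,\dots,0)$. *)

(* Defs.v *)
From mathcomp Require Import all_boot all_order all_algebra finmap.
From mathcomp Require Import all_classical all_reals.
From mathcomp Require Import convex.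

Set Implicit Arguments.
Unset Strict Implicit.
Unset Printing Implicit Defensive.

Import Order.TTheory GRing.Theory Num.Theory.

Local Open Scope classical_set_scope.
Local Open Scope ring_scope.

(* Exponent vectors live in Z^n, so that Laurent shifts J - I make sense; a    *)
(* monomial that is absent from the finite map has coefficient +oo.            *)
Record tpoly (R : realType) (n : nat) := TPoly {
  monomials : {fmap 'rV[int]_n -> R};
  _ : domf monomials != fset0;
  _ : [forall I : domf monomials, forall i, 0 <= val I ord0 i]
}.

Section Tropical.
Variable R : realType.

Definition tcoef n (f : tpoly R n) (I : 'rV[int]_n) : \bar R :=
  if (monomials f).[? I]%fmap is Some a then a%:E else +oo%E.

(* The elements of \bar R play the role of the tropical semi-ring; -oo never   *)
(* occurs as a coefficient.                                                    *)
Definition min_attained_twice (T : Type) (D : set T) (g : T -> \bar R) : Prop :=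
  exists t1 t2 : T, [/\ D t1, D t2, t1 <> t2,
    forall t, D t -> (g t1 <= g t)%E & forall t, D t -> (g t2 <= g t)%E].

Definition dot n (u v : 'rV[R]_n) : R := \sum_(i < n) u ord0 i * v ord0 i.

Definition intpt n (I : 'rV[int]_n) : 'rV[R]_n := map_mx intr I.

Definition tropical_zero n (f : tpoly R n) (x : 'rV[R]_n) : Prop :=
  min_attained_twice [set I | I \in domf (monomials f)]
    (fun I => (tcoef f I + (dot (intpt I) x)%:E)%E).

(* The space R^(n+1), the first component being the height; R^o is R seen as a *)
(* module over itself, which makes the product an lmodType.                    *)
Local Notation pt n := (R^o * 'rV[R]_n)%type.

Definition convex_hull (M : lmodType R) (A : set M) : set M :=
  smallest (@convex_set R M) A.

Definition newton_polyhedron n (f : tpoly R n) : set (pt n) :=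
  [set z | exists2 a,
     convex_hull [set p : pt n | exists2 I,
       p.2 = intpt I & (monomials f).[? I]%fmap = Some p.1] (a, z.2)
     & a <= z.1].

Definition is_min (A : set R) (a : R) : Prop := A a /\ lbound A a.

Definition convex_form n (f : tpoly R n) : Prop :=
  forall I : 'rV[int]_n,
    let heights := [set a : R | newton_polyhedron f (a, intpt I)] in
    (I \in domf (monomials f) <-> heights !=set0) /\
    (forall c, (monomials f).[? I]%fmap = Some c -> is_min heights c).

Definition cayley_matrix n s (f : 'I_s -> tpoly R n)
    (Ij : 'rV[int]_n * 'I_s) (J : 'rV[int]_n) : \bar R :=
  tcoef (f Ij.2) (J - Ij.1).

Definition matrix_tropical_zero (row col : Type) (M : row -> col -> \bar R)
    (y : col -> R) : Prop :=
  forall r : row, min_attained_twice setT (fun J => (M r J + (y J)%:E)%E).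

Definition lies_above n (U V : set (pt n)) : Prop :=
  forall u v w, U (u, w) -> V (v, w) -> v <= u.

Definition translate n (A : set (pt n)) (v : pt n) : set (pt n) :=
  [set z + v | z in A].

Definition at_least_two_points (T : Type) (A : set T) : Prop :=
  exists p q : T, [/\ A p, A q & p <> q].

Definition graph_points n (y : 'rV[int]_n -> R) : set (pt n) :=
  [set (- y J, intpt J) | J in [set: 'rV[int]_n]].

Definition hyperplane n (b : 'rV[R]_n) : set (pt n) :=
  [set z | z.1 + dot b z.2 = 0].

End Tropical.

(* Main.v *)
Require Import Defs.
From mathcomp Require Import all_boot all_order all_algebra finmap.
From mathcomp Require Import all_classical all_reals.
From mathcomp Require Import interval_inference convex.
From mathcomp Require Import lra.

Set Implicit Arguments.
Unset Strict Implicit.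
Unset Printing Implicit Defensive.

Import Order.TTheory GRing.Theory Num.Theory.

Local Open Scope classical_set_scope.
Local Open Scope ring_scope.

(** The pairings agree term by term: both sides say that, for some weight [w] on
    the exponents, the minimum of [coefficient + w] is attained by two
    monomials. For a tropical zero [x], or a hyperplane with normal [(1, x)]
    supporting [P(f)], the weight is [w K = <x, K>]; for the row [I] of the
    Cayley matrix, or for the contact of [P(f) + (a, I)] with [Y], it is
    [w K = y_(K + I)]. The minimum is the opposite of the vertical shift.
    Convexity enters only to see that a supporting hyperplane that meets [P(f)]
    twice contains two monomial points. *)

Section MinTwice.
Variables (R : realType) (n : nat).
Implicit Types (f : tpoly R n) (I J K : 'rV[int]_n) (w y : 'rV[int]_n -> R).
Implicit Types (x b u v : 'rV[R]_n) (A : set (R^o * 'rV[R]_n)).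

Local Notation "f `_[ I ]" := ((monomials f).[? I]%fmap)
  (at level 3, I at level 200, format "f `_[ I ]").

(** * Scalar products, integer points and translates *)

Lemma dotC u v : dot u v = dot v u.
Proof. by apply: eq_bigr => i _; rewrite mulrC. Qed.

Lemma dotDl u v x : dot (u + v) x = dot u x + dot v x.
Proof. by rewrite -big_split; apply: eq_bigr => i _; rewrite mxE mulrDl. Qed.

Lemma dotZl (k : R) u x : dot (k *: u) x = k * dot u x.
Proof. by rewrite /dot mulr_sumr; apply: eq_bigr => i _; rewrite mxE mulrA. Qed.

Lemma intptD I J : intpt R (I + J) = intpt R I + intpt R J.
Proof. by apply/rowP => i; rewrite !mxE intrD. Qed.

Lemma intptB I J : intpt R (I - J) = intpt R I - intpt R J.
Proof. by apply/rowP => i; rewrite !mxE intrB. Qed.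

Lemma intpt_inj : injective (@intpt R n).
Proof.
by move=> I J /rowP IJ; apply/rowP => i; have := IJ i; rewrite !mxE => /intr_inj.
Qed.

Lemma translateE A z t : translate A t z <-> A (z - t).
Proof.
split=> [[p Ap <-]|Azt]; first by rewrite addrK.
by exists (z - t); rewrite ?subrK.
Qed.

Lemma translate_intptE A (a c : R) I J :
  translate A (a, intpt R I) (c, intpt R J) <-> A (c - a, intpt R (J - I)).
Proof. by rewrite translateE intptB. Qed.

(** * Monomials and minima attained twice *)

Lemma tcoefE f I : tcoef f I = if f`_[I] is Some a then a%:E else +oo%E.
Proof. by []. Qed.

Lemma tpoly_neq0 f : exists I c, f`_[I] = Some c.
Proof.
case: f => m m0 ?; have /fset0Pn [I Im] := m0.
by exists I, m.[Im]%fmap; rewrite /= in_fnd.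
Qed.

Lemma tpoly_mem f I c : f`_[I] = Some c -> I \in domf (monomials f).
Proof. by case: fndP. Qed.

(** The value [m] is kept explicit because the vertical shifts in (B) are [- m]. The two coefficient
    equations say at once that both monomials are present and that they attain [m]. *)
Definition min_twice f w (m : R) : Prop :=
  (forall I c, f`_[I] = Some c -> m <= c + w I) /\
  exists I J, [/\ I <> J, f`_[I] = Some (m - w I) & f`_[J] = Some (m - w J)].

Lemma eq_min_twice f w w' m : w =1 w' -> min_twice f w m -> min_twice f w' m.
Proof. by move=> /funext ->. Qed.

Lemma min_twice_addr f w m (k : R) :
  min_twice f w m -> min_twice f (fun I => w I + k) (m + k).
Proof.
move=> [mle [I [J [IJ fI fJ]]]]; split.
  by move=> K c /mle; rewrite addrA lerD2r.
by exists I, J; rewrite fI fJ; split=> //; congr Some; lra.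
Qed.

(** An absent monomial has value [+oo], above that of any present one, so enlarging [D] beyond the
    support changes nothing. This treats the finite tropical sum and the infinite matrix row
    together. *)
Lemma min_attained_twice_tcoef f w (D : set 'rV[int]_n) :
  (forall I, I \in domf (monomials f) -> D I) ->
  min_attained_twice D (fun I => (tcoef f I + (w I)%:E)%E) <->
  exists m, min_twice f w m.
Proof.
move=> fD; split=> [[I [J [DI DJ IJ minI minJ]]]|[m [mle [I [J [IJ fI fJ]]]]]].
  have [K [c fK]] := tpoly_neq0 f.
  have DK := fD _ (tpoly_mem fK).
  have IleJ := minI _ DJ; have JleI := minJ _ DI.
  (* Comparison with the present monomial [K] rules out that [I] or [J] is absent. *)
  have := minI _ DK; have := minJ _ DK; move: IleJ JleI minI.
  rewrite !tcoefE fK; case fI: (f`_[I]) => [cI|//]; case fJ: (f`_[J]) => [cJ|//].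
  rewrite -!EFinD !lee_fin => IleJ JleI minI _ _.
  exists (cI + w I); split.
    move=> L c' fL; have := minI _ (fD _ (tpoly_mem fL)).
    by rewrite tcoefE fL -EFinD lee_fin.
  exists I, J; split=> //; first by rewrite addrK.
  by rewrite fJ; congr Some; lra.
exists I, J.
split; [exact/fD/tpoly_mem/fI | exact/fD/tpoly_mem/fJ | by []| |] => K _.
  rewrite !tcoefE fI; case fK: (f`_[K]) => [c|]; rewrite ?addye ?leey//.
  by rewrite -!EFinD lee_fin subrK mle.
rewrite !tcoefE fJ; case fK: (f`_[K]) => [c|]; rewrite ?addye ?leey//.
by rewrite -!EFinD lee_fin subrK mle.
Qed.

Lemma tropical_zeroP f x :
  tropical_zero f x <-> exists m, min_twice f (fun I => dot x (intpt R I)) m.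
Proof.
rewrite -(@min_attained_twice_tcoef f _ [set I | I \in domf (monomials f)])//.
rewrite /tropical_zero.
by under [X in min_attained_twice _ X <-> _]eq_fun do rewrite dotC.
Qed.

(** The substitution [J = K + I] moves the shift of the row from the coefficients to [y]. *)
Lemma cayley_rowP f y I :
  min_attained_twice setT (fun J => (tcoef f (J - I) + (y J)%:E)%E) <->
  exists m, min_twice f (fun K => y (K + I)) m.
Proof.
rewrite -(@min_attained_twice_tcoef f _ setT)//.
split=> -[J [K [_ _ JK minJ minK]]].
  exists (J - I), (K - I); split=> //.
  - by move/addIr.
  - by move=> L _; have := minJ (L + I) Logic.I; rewrite addrK subrK.
  - by move=> L _; have := minK (L + I) Logic.I; rewrite addrK subrK.
exists (J + I), (K + I); split=> //.
- by move/addIr.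
- by move=> L _; have := minJ (L - I) Logic.I; rewrite addrK subrK.
- by move=> L _; have := minK (L - I) Logic.I; rewrite addrK subrK.
Qed.

(** * Contact of translated Newton polyhedra with [Y] *)

Lemma monomial_newton f I c :
  f`_[I] = Some c -> newton_polyhedron f (c, intpt R I).
Proof.
by move=> fI; exists c => //; apply: sub_gen_smallest; exists I.
Qed.

(** An integer point of the hull may be a combination of monomials with other exponents; convex form
    guarantees a monomial of [f] at or below it. *)
Lemma convex_form_newton f I (a : R) : convex_form f ->
  newton_polyhedron f (a, intpt R I) -> exists2 c, f`_[I] = Some c & c <= a.
Proof.
move=> /(_ I) [dom min] Pa.
have : I \in domf (monomials f) by apply/dom; exists a.
rewrite -fndSome; case fI: (f`_[I]) => [c|//] _; exists c => //.
by have [_] := min _ fI; apply.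
Qed.

(** [Y] has points over integer exponents only, and there convex form makes the monomials the lowest
    points of [P(f)], so testing them suffices. *)
Lemma lies_above_graph f y I (a : R) : convex_form f ->
  lies_above (translate (newton_polyhedron f) (a, intpt R I)) (graph_points y)
  <-> forall K c, f`_[K] = Some c -> - a <= c + y (K + I).
Proof.
move=> cf; split=> [above K c fK|mle u v t].
  have : - y (K + I) <= c + a; last lra.
  apply: (above _ _ (intpt R (K + I))); last by exists (K + I).
  by apply/translate_intptE; rewrite !addrK; exact: monomial_newton.
move=> + [J _ [<- tJ]]; rewrite -tJ.
move=> /translate_intptE/(convex_form_newton cf)[c /mle].
by rewrite subrK; lra.
Qed.

(** A contact is squeezed: convex form puts a monomial at or below it, and lying above [Y] forbids a
    strictly lower one. Hence contacts are monomial points. Conversely, a single touching monomial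
    already makes [a] minimal. *)
Lemma newton_graphP f y I (a : R) : convex_form f ->
  is_min [set c : R | lies_above
    (translate (newton_polyhedron f) (c, intpt R I)) (graph_points y)] a /\
  at_least_two_points
    (translate (newton_polyhedron f) (a, intpt R I) `&` graph_points y)
  <-> min_twice f (fun K => y (K + I)) (- a).
Proof.
move=> cf; split.
  move=> [[/(lies_above_graph _ _ _ cf) mle _]].
  move=> [p [q [[Pp Yp] [Pq Yq] pq]]].
  case: Yp Pp pq => J _ <- /translate_intptE Pp.
  case: Yq Pq => K _ <- /translate_intptE Pq pq.
  have fE L : newton_polyhedron f (- y L - a, intpt R (L - I)) ->
      f`_[L - I] = Some (- a - y (L - I + I)).
    move=> /(convex_form_newton cf)[c fL cle]; rewrite fL.
    by have := mle _ _ fL; rewrite subrK => ?; congr Some; lra.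
  split=> //; exists (J - I), (K - I); split; [|exact: fE|exact: fE].
  by move=> /addIr JK; apply: pq; rewrite JK.
move=> [mle [J [K [JK fJ fK]]]]; split; first split.
- exact/lies_above_graph.
- by move=> a' /(lies_above_graph _ _ _ cf)/(_ _ _ fJ); lra.
have Ypt L : f`_[L] = Some (- a - y (L + I)) ->
  (translate (newton_polyhedron f) (a, intpt R I) `&` graph_points y)
    (- y (L + I), intpt R (L + I)).
  move=> fL; split; last by exists (L + I).
  by apply/translate_intptE; rewrite addrK addrC; exact: monomial_newton.
exists (- y (J + I), intpt R (J + I)), (- y (K + I), intpt R (K + I)).
by split; [exact: Ypt|exact: Ypt|move=> [_ /intpt_inj/addIr]].
Qed.

(** * Supporting hyperplanes of Newton polyhedra *)

Lemma dot_conv b (p q : R^o * 'rV[R]_n) (k : R) (r := k *: p + (1 - k) *: q) :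
  r.1 + dot b r.2 = k * (p.1 + dot b p.2) + (1 - k) * (q.1 + dot b q.2).
Proof.
have -> : r.1 = k * p.1 + (1 - k) * q.1 by [].
have -> : r.2 = k *: p.2 + (1 - k) *: q.2 by [].
rewrite dotC dotDl !dotZl ![dot _ b]dotC; lra.
Qed.

Lemma avg_ge (k m c d : R) : 0 <= k -> k <= 1 -> m <= c -> m <= d ->
  m <= k * c + (1 - k) * d.
Proof. nra. Qed.

Lemma avg_gt (k m c d : R) : 0 < k -> k < 1 -> m <= c -> m <= d ->
  m < c \/ m < d -> m < k * c + (1 - k) * d.
Proof. by move=> k0 k1 mc md [lt|lt]; nra. Qed.

(* If at most one monomial point lies on the hyperplane, this point together with
   the open half-space above is a convex set, so it contains the convex hull. *)
Lemma newton_support f b (m : R) :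
    (forall I c, f`_[I] = Some c -> m <= c + dot b (intpt R I)) ->
  (forall p, newton_polyhedron f p -> m <= p.1 + dot b p.2) /\
  (at_least_two_points
     [set p | newton_polyhedron f p /\ p.1 + dot b p.2 = m] ->
   min_twice f (fun I => dot b (intpt R I)) m).
Proof.
move=> mle.
pose M := [set p : R^o * 'rV[R]_n | exists2 I,
             p.2 = intpt R I & f`_[I] = Some p.1].
have Mle p : M p -> m <= p.1 + dot b p.2 by case=> I ->; exact: mle.
have hull_le p : convex_hull M p -> m <= p.1 + dot b p.2.
  apply: (@smallest_sub _ _ _ [set p | m <= p.1 + dot b p.2]); last exact: Mle.
  move=> {}p q k; rewrite !inE/= => mp mq.
  rewrite /conv/= dot_conv.
  by apply: avg_ge.
split.
  by move=> [a v] [c /hull_le/=]; lra.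
move=> [p [q [[Pp pm] [Pq qm] pq]]]; apply: contrapT => Ntwice.
pose S := [set p : R^o * 'rV[R]_n |
             m < p.1 + dot b p.2 \/ M p /\ p.1 + dot b p.2 = m].
have M_uniq (u v : R^o * 'rV[R]_n) : M u -> u.1 + dot b u.2 = m -> M v -> v.1 + dot b v.2 = m ->
    u = v.
  move=> [I uI fI] um [J vJ fJ] vm; apply: contrapT => uv; apply: Ntwice.
  split=> //; exists I, J; split.
  - move=> IJ; apply: uv; move: fJ uI vJ; rewrite -IJ fI => -[uv1] u2 v2.
    by apply/pair_eqP/andP; split; apply/eqP; rewrite ?uv1 ?u2 ?v2.
  - by rewrite fI; congr Some; rewrite -uI; lra.
  - by rewrite fJ; congr Some; rewrite -vJ; lra.
have hullS (u : R^o * 'rV[R]_n) : convex_hull M u -> S u.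
  apply: (@smallest_sub _ _ _ S); last first.
    move=> {}u Mu; have := Mle _ Mu; rewrite le_eqVlt.
    by case/orP=> [/eqP mu|]; [right|left].
  (* Only weights strictly between 0 and 1 remain, so one endpoint strictly above the hyperplane
     lifts the combination strictly above it. Otherwise both endpoints are monomial points on the
     hyperplane, hence equal. *)
  apply/convex_setW => {}u v; rewrite !inE => Su Sv k k0 k1; rewrite inE.
  have : (m < u.1 + dot b u.2 \/ m < v.1 + dot b v.2) \/ u = v.
    case: Su => [|[Mu um]]; first by left; left.
    case: Sv => [|[Mv vm]]; first by left; right.
    by right; exact: M_uniq.
  case=> [lt|uv]; last by rewrite uv convmm.
  left; rewrite /conv/= dot_conv.
  have uge : m <= u.1 + dot b u.2 by case: Su => [/ltW//|[_ ->]].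
  have vge : m <= v.1 + dot b v.2 by case: Sv => [/ltW//|[_ ->]].
  exact: avg_gt.
have PM (u : R^o * 'rV[R]_n) :
    newton_polyhedron f u -> u.1 + dot b u.2 = m -> M u.
  case: u => u1 u2 [c hullc /= cu] um.
  (* [u] has level exactly [m] and lies at or above the hull point [(c, u2)], whose level is at
     least [m]; so the two coincide. *)
  have uc : c = u1 by have := hull_le _ hullc => /=; lra.
  by case: (hullS _ hullc) => [/=|[]]; rewrite uc //; lra.
by apply: pq; apply: M_uniq => //; apply: PM.
Qed.

Lemma lies_above_hyperplane f b (c : R) :
  lies_above (newton_polyhedron f) (translate (hyperplane b) (- (c, 0))) <->
  forall p, newton_polyhedron f p -> - c <= p.1 + dot b p.2.
Proof.
split=> [above [u t]|mle u v t] Pu.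
  (* This is the height over [t] of the shifted hyperplane. *)
  have : - dot b t - c <= u; last by move=> ? /=; lra.
  apply: (above _ _ t) => //; apply/translateE.
  by rewrite /hyperplane/= oppr0 subr0 opprK; lra.
move=> /translateE; rewrite /hyperplane/= oppr0 subr0 opprK => Hv.
have := mle _ Pu => /=; lra.
Qed.

Lemma newton_hyperplaneP f b (c : R) :
  is_min [set c : R | lies_above (newton_polyhedron f)
                        (translate (hyperplane b) (- (c, 0)))] c /\
  at_least_two_points
    (newton_polyhedron f `&` translate (hyperplane b) (- (c, 0)))
  <-> min_twice f (fun I => dot b (intpt R I)) (- c).
Proof.
have HE p : translate (hyperplane b) (- (c, 0)) p <-> p.1 + dot b p.2 = - c.
  rewrite translateE /hyperplane/= oppr0 subr0 opprK.
  by split; lra.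
split.
  move=> [[/lies_above_hyperplane mle _]].
  move=> [p [q [[Pp /HE pc] [Pq /HE qc] pq]]].
  have [|_ ] := @newton_support f b (- c).
    by move=> I a fI; apply: (mle (_, _)); exact: monomial_newton.
  by apply; exists p, q.
move=> [mle [I [J [IJ fI fJ]]]].
have [Pmle _] := newton_support mle.
split; first split.
- exact/lies_above_hyperplane.
(* The monomial [I] attains [- c], so no smaller shift is possible. *)
- move=> c' /lies_above_hyperplane/(_ _ (monomial_newton fI))/=; lra.
exists (- c - dot b (intpt R I), intpt R I).
exists (- c - dot b (intpt R J), intpt R J).
split; last by move=> [_ /intpt_inj].
- by split; [exact: monomial_newton|apply/HE; rewrite subrK].
- by split; [exact: monomial_newton|apply/HE; rewrite subrK].
Qed.

End MinTwice.

Theorem proposition3p1 (R : realType) :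
  (* (A) *)
  (forall (n s : nat), (1 <= n)%N -> (1 <= s)%N ->
   forall f : 'I_s -> tpoly R n, (forall j, convex_form (f j)) ->
     ((exists x : 'rV[R]_n, forall j, tropical_zero (f j) x) <->
      (exists y : 'rV[int]_n -> R,
         matrix_tropical_zero (cayley_matrix f) y)))
  <->
  (* (B) *)
  (forall (n s : nat), (1 <= n)%N -> (1 <= s)%N ->
   forall f : 'I_s -> tpoly R n, (forall j, convex_form (f j)) ->
   forall (y : 'rV[int]_n -> R) (a : 'rV[int]_n -> 'I_s -> R),
     let P j := newton_polyhedron (f j) in
     let Y := graph_points y in
     (forall I j,
        is_min [set c : R | lies_above (translate (P j) (c, intpt R I)) Y]
          (a I j)) ->
     (forall I j,
        at_least_two_points (translate (P j) (a I j, intpt R I) `&` Y)) ->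
     exists b : 'rV[R]_n,
       forall j, exists c : R,
         is_min [set c : R | lies_above (P j) (translate (hyperplane b) (- (c, 0)))]
           c /\
         at_least_two_points (P j `&` translate (hyperplane b) (- (c, 0)))).
Proof.
split=> AB n s n0 s0 f cf.
- move=> y a P Y amin atwo.
  have [|x xP] := (AB n s n0 s0 f cf).2.
    exists y => -[I j]; apply/cayley_rowP; exists (- a I j).
    by apply/newton_graphP => //; split; [exact: amin|exact: atwo].
  (* The tropical zero itself provides the normal of the hyperplane. *)
  exists x => j; have [m] := (tropical_zeroP (f j) x).1 (xP j).
  by rewrite -[m]opprK => /newton_hyperplaneP; exists (- m).
split=> [[x xP]|[y yP]].
  (* On row [I] this linear family differs from the weight of [x] by the constant
     [dot x (intpt R I)], which leaves the minimizers unchanged. *)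
  exists (fun J => dot x (intpt R J)) => -[I j]; apply/cayley_rowP => /=.
  have [m /(min_twice_addr (dot x (intpt R I))) mP] :=
    (tropical_zeroP (f j) x).1 (xP j).
  exists (m + dot x (intpt R I)); apply: eq_min_twice mP => K.
  by rewrite intptD [RHS]dotC dotDl ![dot _ x]dotC.
(* (B) expects the shifts as a function of [I] and [j], so one is chosen for each row, with sign
   opposite to the minimum. *)
have rowP I j : exists m, min_twice (f j) (fun K => y (K + I)) (- m).
  have [m mP] := (cayley_rowP (f j) y I).1 (yP (I, j)).
  by exists (- m); rewrite opprK.
pose a I j := projT1 (cid (rowP I j)).
have aP I j : min_twice (f j) (fun K => y (K + I)) (- a I j).
  exact: projT2 (cid (rowP I j)).
have [||b bP] := AB n s n0 s0 f cf y a.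
- by move=> I j; have /newton_graphP[] := aP I j.
- by move=> I j; have /newton_graphP[] := aP I j.
exists b => j; apply/tropical_zeroP; have [c /newton_hyperplaneP bc] := bP j.
by exists (- c).
Qed.
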